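(* Let $G$ be a locally compact group, $H$ a closed normal subgroup of $G$, and $\omega$ a weight on $G$ bounded away from zero. Let $g\ge0$ be a continuous function on $G$ for which there is a constant $c>0$ such that $$\int_H g(xh)\,dh=1\quad\text{and}\quad\int_H g(xh)\,\omega(xh)\,dh\le c\,\hat\omega([x])\qquad(x\in G).$$ Then the mapping $P:L^1(G,\omega)\to L^1(G,\omega)$ defined by $$(Pf)(x)=(Tf)([x])\,g(x)\quad(x\in G,\ f\in L^1(G,\omega))$$ is a continuous projection whose kernel is $J_\omega(G,H)$.
   Context: A weight on $G$ is a continuous function $\omega:G\to(0,\infty)$ with $\omega(xy)\le\omega(x)\omega(y)$ for all $x,y\in G$ (continuity is a standing assumption). $L^1(G,\omega)=\{f: f\omega\in L^1(G)\}$ (left Haar measure) with norm $\|f\|_\omega=\int_G|f(x)|\omega(x)\,dx$ and convolution product is a Banach algebra. $[x]$ denotes the coset $xH$ in $G/H$, and $\hat\omega([x])=\inf_{h\in H}\omega(xh)$; since $\omega$ is bounded away from zero, $\hat\omega$ is a locally bounded measurable submultiplicative positive function on $G/H$, and $L^1(G/H,\hat\omega)$ is defined in the same way. $dh$ is a left Haar measure on $H$, and Haar measures on $G,H,G/H$ are normalized so that Weil's formula $\int_G f(x)\,dx=\int_{G/H}\int_H f(xh)\,dh\,d[x]$ holds. $T:L^1(G,\omega)\to L^1(G/H,\hat\omega)$ is the standard surjective Banach algebra homomorphism $(Tf)([x])=\int_H f(xh)\,dh$, and $J_\omega(G,H)=\ker T$. (Functions $g$ with the stated properties always exist under the stated hypotheses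 on $G$, $H$, $\omega$.) *)

(* Defs.v *)
From HB Require Import structures.
From mathcomp Require Import all_boot all_order all_algebra.
From mathcomp Require Import ring_quotient complex.
From mathcomp Require Import all_classical all_reals all_analysis.
From mathcomp Require Import measurable_realfun.
Set Implicit Arguments.
Unset Strict Implicit.
Unset Printing Implicit Defensive.
Import Order.TTheory GRing.Theory Num.Theory.
Import numFieldNormedType.Exports.
Local Open Scope classical_set_scope.
Local Open Scope complex_scope.
Local Open Scope ring_scope.

HB.mixin Record isTopologicalGroup G of Topological G & Group G := {
  mulg_continuous : continuous (fun p : G * G => (p.1 * p.2)%g);
  invg_continuous : continuous (fun x : G => (x^-1)%g)
}.

(* Pointed is only there because measurable types are pointed in the library. *)
#[short(type="topologicalGroupType")]
HB.structure Definition TopologicalGroup :=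
  {G of Topological G & Pointed G & Group G & isTopologicalGroup G}.

Definition borel (G : topologicalGroupType) := g_sigma_algebraType (@open G).
HB.instance Definition _ (G : topologicalGroupType) :=
  Measurable.on (borel G).

Record normalSubgroup (G : groupType) := NormalSubgroup {
  ns_set :> set G;
  ns1 : ns_set 1%g;
  nsM : forall x y, ns_set x -> ns_set y -> ns_set (x * y)%g;
  nsV : forall x, ns_set x -> ns_set (x^-1)%g;
  nsJ : forall x y, ns_set x -> ns_set (x ^ y)%g
}.

Section Subgroup.
Variables (G : topologicalGroupType) (N : normalSubgroup G).

Definition subgroup_of : Type := set_type N.
HB.instance Definition _ := Topological.on subgroup_of.
HB.instance Definition _ := SubChoice.on subgroup_of.

Definition subg_incl (h : subgroup_of) : G := \val h.

Lemma subg_inclP (h : subgroup_of) : ns_set N (subg_incl h).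
Proof. exact: (set_mem (valP h)). Qed.

Definition Subg (x : G) (Nx : ns_set N x) : subgroup_of := exist _ x (mem_set Nx).

Definition subg_one := Subg (ns1 N).
Definition subg_mul (h k : subgroup_of) :=
  Subg (nsM (subg_inclP h) (subg_inclP k)).
Definition subg_inv (h : subgroup_of) := Subg (nsV (subg_inclP h)).

Let subg_mulA : associative subg_mul.
Proof. by move=> x y z; apply: val_inj; rewrite /= mulgA. Qed.
Let subg_mul1 : left_id subg_one subg_mul.
Proof. by move=> x; apply: val_inj; rewrite /= mul1g. Qed.
Let subg_mulr1 : right_id subg_one subg_mul.
Proof. by move=> x; apply: val_inj; rewrite /= mulg1. Qed.
Let subg_mulV : left_inverse subg_one subg_inv subg_mul.
Proof. by move=> x; apply: val_inj; rewrite /= mulVg. Qed.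
Let subg_mulrV : right_inverse subg_one subg_inv subg_mul.
Proof. by move=> x; apply: val_inj; rewrite /= mulgV. Qed.

HB.instance Definition _ := isGroup.Build subgroup_of
 subg_mulA subg_mul1 subg_mulr1 subg_mulV subg_mulrV.
HB.instance Definition _ := isPointed.Build subgroup_of 1%g.

Lemma subg_inclM (h k : subgroup_of) :
  subg_incl (h * k)%g = (subg_incl h * subg_incl k)%g.
Proof. by []. Qed.

Lemma subg_inclV (h : subgroup_of) : subg_incl h^-1%g = (subg_incl h)^-1%g.
Proof. by []. Qed.

Lemma subg_incl_continuous : continuous subg_incl.
Proof. exact: initial_continuous. Qed.


Let subg_mul_continuous :
  continuous (fun p : subgroup_of * subgroup_of => (p.1 * p.2)%g).
Proof.
apply: (@continuous_comp_initial _ _ _ subg_incl) => p.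
apply: (@continuous2_cvg _ _ _ _ _ _
  (fun q => subg_incl q.1) (fun q => subg_incl q.2) (fun x y => (x * y)%g)).
- exact: (@mulg_continuous G (subg_incl p.1, subg_incl p.2)).
- apply: cvg_comp; first exact: cvg_fst.
  exact: subg_incl_continuous.
- apply: cvg_comp; first exact: cvg_snd.
  exact: subg_incl_continuous.
Qed.

Let subg_inv_continuous : continuous (fun h : subgroup_of => (h^-1)%g).
Proof.
apply: (@continuous_comp_initial _ _ _ subg_incl) => h.
apply: (@continuous_comp _ _ _ subg_incl (fun x => (x^-1)%g)).
  exact: subg_incl_continuous.
exact: invg_continuous.
Qed.

HB.instance Definition _ := isTopologicalGroup.Build subgroup_of
  subg_mul_continuous subg_inv_continuous.
End Subgroup.

Section Quotient.
Variables (G : topologicalGroupType) (N : normalSubgroup G).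
Local Open Scope quotient_scope.

Definition coset_rel (x y : G) : bool := `[< ns_set N (x^-1 * y)%g >].

Let coset_rel_refl : reflexive coset_rel.
Proof. by move=> x; apply/asboolP; rewrite mulVg; exact: ns1. Qed.

Let coset_rel_sym : symmetric coset_rel.
Proof.
by move=> x y; apply/asboolP/asboolP => /nsV; rewrite invgM invgK.
Qed.

Let coset_rel_trans : transitive coset_rel.
Proof.
move=> y x z /asboolP xy /asboolP yz; apply/asboolP.
by have := nsM xy yz; rewrite -mulgA mulVKg.
Qed.

Canonical coset_rel_equiv :=
  EquivRel coset_rel coset_rel_refl coset_rel_sym coset_rel_trans.

Definition quotient_of : Type := quotient_topology {eq_quot coset_rel}.
HB.instance Definition _ := Topological.on quotient_of.
HB.instance Definition _ := Quotient.on quotient_of.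

Definition coset_of (x : G) : quotient_of := \pi_(quotient_of) x.

Lemma coset_ofP (x y : G) : coset_of x = coset_of y <-> ns_set N (x^-1 * y)%g.
Proof.
split=> [/eqmodP/asboolP //|xy].
by apply/eqmodP/asboolP.
Qed.

Lemma coset_of_repr (q : quotient_of) : coset_of (repr q) = q.
Proof. exact: reprK. Qed.

Definition quo_mul (p q : quotient_of) := coset_of (repr p * repr q)%g.
Definition quo_inv (p : quotient_of) := coset_of (repr p)^-1%g.

Lemma quo_mulE x y : quo_mul (coset_of x) (coset_of y) = coset_of (x * y)%g.
Proof.
have /coset_ofP hx := coset_of_repr (coset_of x).
have /coset_ofP hy := coset_of_repr (coset_of y).
apply/coset_ofP; set a := repr _ in hx *; set b := repr _ in hy *.
have -> : ((a * b)^-1 * (x * y) = ((a^-1 * x) ^ b) * (b^-1 * y))%g.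
  by rewrite conjgE invgM !mulgA mulgK.
by apply: nsM => //; exact: nsJ.
Qed.

Lemma quo_invE x : quo_inv (coset_of x) = coset_of x^-1%g.
Proof.
have /coset_ofP hx := coset_of_repr (coset_of x).
apply/coset_ofP; set a := repr _ in hx *.
have -> : ((a^-1)^-1 * x^-1 = ((a^-1 * x)^-1) ^ (a^-1))%g.
  by rewrite conjgE invgM !invgK mulgK.
by apply: nsJ; exact: nsV.
Qed.

Let quo_mulA : associative quo_mul.
Proof.
move=> x y z; rewrite -(coset_of_repr x) -(coset_of_repr y) -(coset_of_repr z).
by rewrite !quo_mulE mulgA.
Qed.
Let quo_mul1 : left_id (coset_of 1%g) quo_mul.
Proof. by move=> x; rewrite -(coset_of_repr x) quo_mulE mul1g. Qed.
Let quo_mulr1 : right_id (coset_of 1%g) quo_mul.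
Proof. by move=> x; rewrite -(coset_of_repr x) quo_mulE mulg1. Qed.
Let quo_mulV : left_inverse (coset_of 1%g) quo_inv quo_mul.
Proof. by move=> x; rewrite -(coset_of_repr x) quo_invE quo_mulE mulVg. Qed.
Let quo_mulrV : right_inverse (coset_of 1%g) quo_inv quo_mul.
Proof. by move=> x; rewrite -(coset_of_repr x) quo_invE quo_mulE mulgV. Qed.

HB.instance Definition _ := isGroup.Build quotient_of
  quo_mulA quo_mul1 quo_mulr1 quo_mulV quo_mulrV.
HB.instance Definition _ := isPointed.Build quotient_of 1%g.

Lemma coset_of_continuous : continuous coset_of.
Proof. exact: pi_continuous. Qed.

Lemma mulgr_continuous (a : G) : continuous (fun x : G => (x * a)%g).
Proof.
move=> x; apply: (@continuous2_cvg _ _ _ _ _ _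
  id (fun=> a) (fun x y => (x * y)%g)); last exact: cvg_cst.
  exact: (@mulg_continuous G (x, a)).
exact: cvg_id.
Qed.

Lemma coset_of_open (U : set G) : open U -> open (coset_of @` U).
Proof.
move=> oU; rewrite /open/= /quotient_open.
have -> : \pi_(quotient_of) @^-1` (coset_of @` U) =
    \bigcup_(n in ns_set N) ((fun x : G => (x * n)%g) @^-1` U).
  apply/seteqP; split => x /=.
    case=> u Uu /coset_ofP/nsV; rewrite invgM invgK => Nux.
    by exists (x^-1 * u)%g => //=; rewrite mulVKg.
  case=> n Nn /= Uxn; exists (x * n)%g => //.
  by apply/coset_ofP; rewrite invgM mulgVK; exact: nsV.
apply: bigcup_open => n _; apply: open_comp => // x _.
exact: mulgr_continuous.
Qed.

Let quo_mul_continuous :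
  continuous (fun p : quotient_of * quotient_of => (p.1 * p.2)%g).
Proof.
move=> [p q] U /=; rewrite nbhsE /= => -[V [oV Vpq] VU].
have := @mulg_continuous G (repr p, repr q) (coset_of @^-1` V).
case.
  apply: open_nbhs_nbhs; split.
    by apply: open_comp => // x _; exact: coset_of_continuous.
  exact: Vpq.
move=> [A B] /= [nA nB] AB.
exists (coset_of @` A, coset_of @` B) => /=.
  split.
  - have := nA; rewrite nbhsE => -[A' [oA' A'p] A'A].
    apply: (@filterS _ _ _ (coset_of @` A')); first exact: image_subset.
    apply: open_nbhs_nbhs; split; first exact: coset_of_open.
    by exists (repr p) => //; exact: coset_of_repr.
  - have := nB; rewrite nbhsE => -[B' [oB' B'q] B'B].
    apply: (@filterS _ _ _ (coset_of @` B')); first exact: image_subset.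
    apply: open_nbhs_nbhs; split; first exact: coset_of_open.
    by exists (repr q) => //; exact: coset_of_repr.
move=> [_ _] /= [[a Aa <-] [b Bb <-]]; apply: VU.
rewrite [X in V X](quo_mulE a b).
exact: (AB (a, b)).
Qed.

Let quo_inv_continuous : continuous (fun p : quotient_of => (p^-1)%g).
Proof.
apply/continuousP => V oV; rewrite /open/= /quotient_open.
rewrite (_ : _ @^-1` _ =
  (fun x : G => (x^-1)%g) @^-1` (coset_of @^-1` V)).
  apply: open_comp => [x _|]; first exact: invg_continuous.
  by apply: open_comp => // x _; exact: coset_of_continuous.
by apply/seteqP; split => x /=; rewrite -(quo_invE x).
Qed.

HB.instance Definition _ := isTopologicalGroup.Build quotient_of
  quo_mul_continuous quo_inv_continuous.
End Quotient.

Section HaarMeasure.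
Local Open Scope ereal_scope.
Context (R : realType) (G : topologicalGroupType).

(* Left Haar measures as Radon measures on the Borel sets: outer regular on
   Borel sets, inner regular on open sets. On groups that are not sigma-compact
   it is outer regularity that keeps the support of an integrable function
   inside a sigma-compact open set, as Weil's formula on L^1 requires. *)
Definition left_haar (mu : {measure set (borel G) -> \bar R}) : Prop :=
  [/\ mu [set: G] != 0,
      forall (x : G) (A : set G), measurable (A : set (borel G)) ->
        mu [set (x * y)%g | y in A] = mu A,
      forall K : set G, compact K -> mu K < +oo,
      forall A : set G, measurable (A : set (borel G)) ->
        mu A = ereal_inf [set mu U | U in [set U : set G | open U /\ A `<=` U]] &
      forall U : set G, open U ->
        mu U = ereal_sup [set mu K | K in [set K : set G | compact K /\ K `<=` U]]].

End HaarMeasure.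

Section ComplexIntegral.
Context d (T : measurableType d) (R : realType).
Variable mu : {measure set T -> \bar R}.

Definition cintegrable (f : T -> R[i]) : Prop :=
  mu.-integrable [set: T] (fun x => (complex.Re (f x))%:E) /\
  mu.-integrable [set: T] (fun x => (complex.Im (f x))%:E).

Definition cintegral (f : T -> R[i]) : R[i] :=
  (\int[mu]_x complex.Re (f x)) +i* (\int[mu]_x complex.Im (f x)).

End ComplexIntegral.

Section WeightedL1.
Context d (T : measurableType d) (R : realType).
Variables (mu : {measure set T -> \bar R}) (w : T -> R).

(* L^1(mu, w) = {f | f w in L^1(mu)}, first as a space of functions, then
   (wL1 below) modulo equality almost everywhere, normed by int |f| w. *)
Definition wLfun_pred : {pred T -> R[i]} :=
  fun f => `[< cintegrable mu (fun x => f x * (w x)%:C) >].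

Lemma Re_scale (a z : R[i]) : complex.Re (a * z) = complex.Re a * complex.Re z - complex.Im a * complex.Im z.
Proof. by case: a z => [? ?] [? ?]. Qed.
Lemma Im_scale (a z : R[i]) : complex.Im (a * z) = complex.Re a * complex.Im z + complex.Im a * complex.Re z.
Proof. by case: a z => [? ?] [? ?]. Qed.

Lemma cintegrableD f g : cintegrable mu f -> cintegrable mu g ->
  cintegrable mu (fun x => f x + g x).
Proof.
move=> [fr fi] [gr gi]; split.
- rewrite (_ : (fun _ => _) =
     (fun x => (complex.Re (f x))%:E) \+ (fun x => (complex.Re (g x))%:E))%E.
    exact: integrableD.
  by apply/funext => x; rewrite /= raddfD.
- rewrite (_ : (fun _ => _) =
     (fun x => (complex.Im (f x))%:E) \+ (fun x => (complex.Im (g x))%:E))%E.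
    exact: integrableD.
  by apply/funext => x; rewrite /= raddfD.
Qed.

Lemma cintegrableZ (a : R[i]) f : cintegrable mu f ->
  cintegrable mu (fun x => a * f x).
Proof.
move=> [fr fi]; split.
- rewrite (_ : (fun _ => _) =
     (fun x => (complex.Re a)%:E * (complex.Re (f x))%:E) \-
     (fun x => (complex.Im a)%:E * (complex.Im (f x))%:E))%E.
    by apply: integrableB => //; exact: integrableZl.
  by apply/funext => x; rewrite /= Re_scale.
- rewrite (_ : (fun _ => _) =
     (fun x => (complex.Re a)%:E * (complex.Im (f x))%:E) \+
     (fun x => (complex.Im a)%:E * (complex.Re (f x))%:E))%E.
    by apply: integrableD => //; exact: integrableZl.
  by apply/funext => x; rewrite /= Im_scale.
Qed.

Lemma wLfun_submod_closed : submod_closed wLfun_pred.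
Proof.
split.
  apply/asboolP; rewrite (_ : (fun _ => _) = cst 0).
    by split; exact: integrable0.
  by apply/funext => x; rewrite /= mul0r.
move=> a f g /asboolP fw /asboolP gw; apply/asboolP.
rewrite (_ : (fun _ => _) =
  (fun x => a * (f x * (w x)%:C) + g x * (w x)%:C)).
  by apply: cintegrableD => //; exact: cintegrableZ.
by apply/funext => x; rewrite mulrA -mulrDl.
Qed.

HB.instance Definition _ := GRing.isSubmodClosed.Build R[i] (T -> R[i])
  wLfun_pred wLfun_submod_closed.

Record wLfun := WLfun { wLfun_val :> T -> R[i]; _ : wLfun_val \in wLfun_pred }.
HB.instance Definition _ := [isSub for wLfun_val].
HB.instance Definition _ := [Choice of wLfun by <:].
HB.instance Definition _ := [SubChoice_isSubLmodule of wLfun by <:].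

Definition aezero_pred : {pred wLfun} :=
  fun f => `[< \forall x \ae mu, f x = 0 >].

Lemma aezero_zmod_closed : zmod_closed aezero_pred.
Proof.
split; first by apply/asboolP; exact: nearW.
move=> f g /asboolP f0 /asboolP g0; apply/asboolP.
apply: filterS2 f0 g0 => x /= fx gx.
by transitivity (f x - g x) => //; rewrite fx gx subr0.
Qed.

HB.instance Definition _ := GRing.isZmodClosed.Build wLfun aezero_pred
  aezero_zmod_closed.


Definition wLnorm (f : T -> R[i]) : R := \int[mu]_x (Normc.normc (f x) * w x).

Hypothesis w_gt0 : forall x, 0 < w x.

Definition wL1 & (forall x, 0 < w x) : Type :=
  Quotient.quot aezero_pred.
Local Notation L1 := (wL1 w_gt0).
HB.instance Definition _ := GRing.Zmodule.on L1.
HB.instance Definition _ := EqQuotient.on L1.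

Definition wL1_class (f : wLfun) : L1 := \pi_(L1)%qT f.
Definition wL1_fun (f : L1) : T -> R[i] := wLfun_val (repr f).

Lemma wL1_eqP (f g : wLfun) :
  wL1_class f = wL1_class g <-> (f : T -> R[i]) = g %[ae mu].
Proof.
split.
  move=> /eqP; rewrite /wL1_class eqmodE /= /Quotient.equiv => /asboolP.
  apply: filterS => x fgx _; apply/eqP; rewrite -subr_eq0; apply/eqP.
  exact: fgx.
move=> fg; apply/eqP; rewrite /wL1_class eqmodE /= /Quotient.equiv.
apply/asboolP; apply: filterS fg => x /= /(_ I) fgx.
by transitivity (f x - g x) => //; rewrite fgx subrr.
Qed.

Lemma wL1_funK (f : L1) : wL1_class (repr f) = f.
Proof. exact: reprK. Qed.

Lemma wL1_classK (f : wLfun) : wL1_fun (wL1_class f) = f %[ae mu].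
Proof. by apply/wL1_eqP; rewrite wL1_funK. Qed.

Lemma wL1_classD (f g : wLfun) :
  wL1_class (f + g) = wL1_class f + wL1_class g.
Proof. exact: (Quotient.pi_add aezero_pred). Qed.

Definition wL1_scale (a : R[i]) (f : L1) : L1 := wL1_class (a *: repr f).

Lemma wL1_scaleE a (f : wLfun) : wL1_scale a (wL1_class f) = wL1_class (a *: f).
Proof.
apply/wL1_eqP; have := wL1_classK f; rewrite /wL1_fun; apply: filterS => x fx _.
by transitivity (a * repr (wL1_class f) x) => //; rewrite fx.
Qed.

Let wL1_scaleA a b f : wL1_scale a (wL1_scale b f) = wL1_scale (a * b) f.
Proof. by rewrite -(wL1_funK f) !wL1_scaleE scalerA. Qed.
Let wL1_scale1 : left_id 1 wL1_scale.
Proof. by move=> f; rewrite -(wL1_funK f) wL1_scaleE scale1r. Qed.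
Let wL1_scaleDr : right_distributive wL1_scale +%R.
Proof.
move=> a f g; rewrite -(wL1_funK f) -(wL1_funK g).
by rewrite -wL1_classD !wL1_scaleE -wL1_classD scalerDr.
Qed.
Let wL1_scaleDl f : {morph wL1_scale^~ f : a b / a + b}.
Proof.
by move=> a b; rewrite -(wL1_funK f) !wL1_scaleE -wL1_classD scalerDl.
Qed.

HB.instance Definition _ := GRing.Zmodule_isLmodule.Build R[i] L1
  wL1_scaleA wL1_scale1 wL1_scaleDr wL1_scaleDl.

Lemma wL1_classZ a (f : wLfun) : wL1_class (a *: f) = a *: wL1_class f.
Proof. by rewrite -wL1_scaleE. Qed.

Lemma wL1_class0 : wL1_class 0 = 0.
Proof. by rewrite -[RHS](scale0r (wL1_class 0)) -wL1_classZ scale0r. Qed.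

Lemma normc_scale (z : R[i]) (r : R) : 0 < r ->
  Normc.normc (z * r%:C) = Normc.normc z * r.
Proof.
move=> r0; rewrite Normc.normcM; congr (_ * _).
by rewrite /= expr0n /= addr0 sqrtr_sqr gtr0_norm.
Qed.

Lemma wLfun_integrable (f : wLfun) :
  mu.-integrable [set: T] (fun x => (Normc.normc (f x) * w x)%:E).
Proof.
have /asboolP [fr fi] : (f : T -> R[i]) \in wLfun_pred by exact: valP.
rewrite (_ : (fun x => _) = fun x => (Num.sqrt
   (complex.Re (f x * (w x)%:C) ^+ 2 + complex.Im (f x * (w x)%:C) ^+ 2))%:E);
  last first.
  apply/funext => x; rewrite -normc_scale//.
  by case: (f x * _).
have mr := measurable_int _ fr; have mi := measurable_int _ fi.
apply: (le_integrable measurableT _ _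
  (integrableD measurableT (integrable_abse fr) (integrable_abse fi))).
  apply/measurable_EFinP; apply: measurableT_comp.
    by apply: continuous_measurable_fun; exact: sqrt_continuous.
  apply: measurable_funD; apply: measurable_funX; exact/measurable_EFinP.
move=> x _ /=.
rewrite lee_fin ger0_norm ?sqrtr_ge0// ger0_norm ?addr_ge0//.
rewrite -[leRHS]ger0_norm ?addr_ge0// -sqrtr_sqr ler_wsqrtr// sqrrD.
rewrite !real_normK ?num_real// -addrA lerD2l lerDr mulrn_wge0 ?mulr_ge0//.
Qed.

Lemma wLnorm_eq (f g : wLfun) :
  (f : T -> R[i]) = g %[ae mu] -> wLnorm f = wLnorm g.
Proof.
move=> fg; congr fine; apply: ae_eq_integral => //.
- exact: measurable_int (wLfun_integrable f).
- exact: measurable_int (wLfun_integrable g).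
- by apply: filterS fg => x /= /(_ I) ->.
Qed.

Definition wL1_norm (f : L1) : R[i] := (wLnorm (wL1_fun f))%:C.

Lemma wL1_normE (f : wLfun) : wL1_norm (wL1_class f) = (wLnorm f)%:C.
Proof. by congr (_%:C); apply: wLnorm_eq; exact: wL1_classK. Qed.

Let wL1_normD f g : wL1_norm (f + g) <= wL1_norm f + wL1_norm g.
Proof.
rewrite -(wL1_funK f) -(wL1_funK g) -wL1_classD !wL1_normE -rmorphD lecR.
rewrite -RintegralD//; try exact: wLfun_integrable.
apply: le_Rintegral => //.
- exact: wLfun_integrable.
- exact: (integrableD measurableT (wLfun_integrable (repr f))
           (wLfun_integrable (repr g))).
- move=> x _; rewrite -mulrDl; apply: ler_wpM2r; first exact: ltW.
  exact: (le_normcD (repr f x) (repr g x)).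
Qed.

Let wL1_normZ a f : wL1_norm (a *: f) = `|a| * wL1_norm f.
Proof.
rewrite -(wL1_funK f) -wL1_classZ !wL1_normE.
rewrite (_ : `|a| = (Normc.normc a)%:C)// -rmorphM; congr (_%:C).
rewrite -RintegralZl//; last exact: wLfun_integrable.
by apply: eq_Rintegral => x _; rewrite mulrA -Normc.normcM.
Qed.

Let wL1_norm0 f : wL1_norm f = 0 -> f = 0.
Proof.
rewrite -(wL1_funK f) wL1_normE => -[] n0.
rewrite -wL1_class0; apply/wL1_eqP.
have int := wLfun_integrable (repr f).
have : (\int[mu]_x `|(Normc.normc (repr f x) * w x)%:E| = 0)%E.
  have n_ge0 x : 0 <= Normc.normc (repr f x) * w x.
    apply: mulr_ge0; last exact: ltW.
    by case: (wLfun_val _ _) => a b; exact: sqrtr_ge0.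
  under eq_integral do rewrite gee0_abs ?lee_fin//.
  rewrite -[LHS]fineK; last exact: integrable_fin_num.
  by rewrite -[X in _ = X]/(0%:E); congr EFin.
move/ae_eq_integral_abs => /(_ measurableT (measurable_int _ int)).
apply: filterS => x /(_ I)[] /eqP; rewrite mulf_eq0 (gt_eqF (w_gt0 x)) orbF.
by move=> /eqP /Normc.eq0_normc.
Qed.

HB.instance Definition _ := Lmodule_isNormed.Build R[i] L1
  wL1_normD wL1_normZ wL1_norm0.
End WeightedL1.

Lemma wL1_normrE d (T : measurableType d) (R : realType)
    (mu : {measure set T -> \bar R}) (w : T -> R) (w_gt0 : forall x, 0 < w x)
    (f : wL1 mu w_gt0) :
  `|f| = (\int[mu]_x (Normc.normc (wL1_fun f x) * w x))%:C.
Proof. by []. Qed.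

Section Cosets.
Context (R : realType) (G : topologicalGroupType) (N : normalSubgroup G).
Implicit Types (q : quotient_of N) (h : subgroup_of N).

(* Functions on G/H are evaluated at a coset q through its representative
   repr q; by left invariance on H the values do not depend on that choice. *)
Definition hat_weight (w : G -> R) q : R :=
  inf [set w (repr q * subg_incl h)%g | h in [set: subgroup_of N]].

Lemma hat_weight_coset_of (w : G -> R) (x : G) :
  hat_weight w (coset_of N x) =
  inf [set w (x * subg_incl h)%g | h in [set: subgroup_of N]].
Proof.
have /coset_ofP Nx := coset_of_repr (coset_of N x).
rewrite /hat_weight; set r := repr _ in Nx *; congr inf.
apply/seteqP; split => _ [h _ <-].
- exists ((Subg Nx)^-1 * h)%g => //; congr w.
  by rewrite subg_inclM subg_inclV /= invgM invgK mulgA mulVKg.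
- exists (Subg Nx * h)%g => //; congr w.
  by rewrite subg_inclM /= mulgA mulVKg.
Qed.

(* (T f)(q) = int_H f(xh) dh for q = [x]. *)
Definition coset_integral (mH : {measure set (borel (subgroup_of N)) -> \bar R})
    (f : G -> R[i]) q : R[i] :=
  cintegral mH (fun h => f (repr q * subg_incl h)%g).

(* Stated for all f in L^1(G); the integrability of the inner integral is what
   makes the right-hand side meaningful. Complex f follow by linearity. *)
Definition weil_formula (mG : {measure set (borel G) -> \bar R})
    (mH : {measure set (borel (subgroup_of N)) -> \bar R})
    (mQ : {measure set (borel (quotient_of N)) -> \bar R}) : Prop :=
  forall f : G -> R, mG.-integrable [set: G] (fun x => (f x)%:E) ->
    mQ.-integrable [set: quotient_of N]
      (fun q => \int[mH]_h (f (repr q * subg_incl h)%g)%:E)%E /\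
    (\int[mG]_x (f x)%:E =
     \int[mQ]_q \int[mH]_h (f (repr q * subg_incl h)%g)%:E)%E.

(* ker T: the zero of L^1(G/H, hat_weight w) is the class of the functions that
   vanish almost everywhere on G/H. *)
Definition kernel_ideal (mG : {measure set (borel G) -> \bar R})
    (mH : {measure set (borel (subgroup_of N)) -> \bar R})
    (mQ : {measure set (borel (quotient_of N)) -> \bar R})
    (w : G -> R) (w_gt0 : forall x, 0 < w x) : set (wL1 mG w_gt0) :=
  [set f : wL1 mG w_gt0 | coset_integral mH (wL1_fun f) = (fun=> 0) %[ae mQ]].

End Cosets.
Arguments kernel_ideal {R G N} mG mH mQ {w} w_gt0.

(* Main.v *)
Require Import Defs.
From HB Require Import structures.
From mathcomp Require Import all_boot all_order all_algebra.
From mathcomp Require Import complex.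
From mathcomp Require Import all_classical all_reals all_analysis.
From mathcomp Require Import measurable_realfun.
Set Implicit Arguments.
Unset Strict Implicit.
Unset Printing Implicit Defensive.
Import Order.TTheory GRing.Theory Num.Theory.
Import numFieldNormedType.Exports.
Local Open Scope classical_set_scope.
Local Open Scope complex_scope.
Local Open Scope ring_scope.

(* Pointwise on a coset, |Tf([x])| hat_w([x]) <= int_H |f(xh)| w(xh) dh, so
   int_H |Tf([x])| g(xh) w(xh) dh <= c int_H |f(xh)| w(xh) dh, and Weil's formula
   bounds the norm of Pf.  Since T(Pf) = Tf on every coset, P is a projection.
   As G need not be sigma-compact, Weil's formula only applies to functions
   already known to be integrable, and preimages of null sets of G/H are only
   locally null in G.  Both problems are settled by the estimate
   t mG({g > t} /\ [E H]) <= mQ(E): for E open it follows from inner regularity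
   of mG on open sets and Weil's formula for indicators of compact sets, and then
   for Borel E from outer regularity of mQ.  It makes {g > 0} /\ {Tf o [.] <> 0}
   sigma-finite, and {g > 0} /\ [E H] null when E is. *)

(** * Borel measurability and elementary integral estimates *)

Lemma borel_open (G : topologicalGroupType) (U : set G) :
  open U -> measurable (U : set (borel G)).
Proof. by move=> oU; exact: sub_sigma_algebra. Qed.

Lemma continuous_measurable_borel (G1 G2 : topologicalGroupType)
    (f : G1 -> G2) : continuous f ->
  measurable_fun [set: borel G1] (f : borel G1 -> borel G2).
Proof.
move=> /continuousP cf; apply: (measurability (@open G2 : set (set (borel G2)))) => //.
by move=> _ [U oU <-]; rewrite setTI; apply: borel_open; exact: cf.
Qed.

Lemma continuous_measurable_real (R : realType) (G : topologicalGroupType)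
    (f : G -> R) : continuous f -> measurable_fun [set: borel G] (f : borel G -> R).
Proof.
move=> /continuousP cf; apply: (measurability _ (RGenOpens.measurableE R)).
move=> _ [U [a [b ->]] <-]; rewrite setTI; apply: borel_open; apply: cf.
exact: interval_open.
Qed.

Lemma ge0_le_integralT d (T : measurableType d) (R : realType)
    (mu : {measure set T -> \bar R}) (f1 f2 : T -> \bar R) :
  measurable_fun [set: T] f1 -> measurable_fun [set: T] f2 ->
  (forall x, 0 <= f1 x)%E -> (forall x, f1 x <= f2 x)%E ->
  (\int[mu]_x f1 x <= \int[mu]_x f2 x)%E.
Proof. by move=> ? ? f10 f12; apply: ge0_le_integral => // x _; exact: f12. Qed.

(** These functions serve twice: as test functions in Weil's formula, and as integrable majorants
    when a function is truncated. *)
Lemma integrable_scale_indic d (T : measurableType d) (R : realType)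
    (mu : {measure set T -> \bar R}) (t : R) (A : set T) :
  measurable A -> (mu A < +oo)%E ->
  mu.-integrable [set: T] (fun x => (t * \1_A x)%:E).
Proof.
move=> mA Aoo; have : mu.-integrable [set: T] (fun x => (\1_A x)%:E).
  apply/integrableP; split.
    by apply/measurable_EFinP; exact: measurable_indic.
  under eq_integral do rewrite gee0_abs ?lee_fin//.
  by rewrite integral_indic// setIT.
by move=> /(integrableZl measurableT t); under eq_fun do rewrite -EFinM.
Qed.

Lemma integral_le_measure d (T : measurableType d) (R : realType)
    (mu : {measure set T -> \bar R}) (A : set T) (f : T -> \bar R) :
  measurable A -> measurable_fun [set: T] f -> (forall x, 0 <= f x)%E ->
  (forall x, A x -> f x <= 1)%E -> (forall x, ~ A x -> f x = 0)%E ->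
  (\int[mu]_x f x <= mu A)%E.
Proof.
move=> mA mf f0 fA fNA; rewrite -[leRHS]/(mu A) -(setIT A) -integral_indic//.
apply: ge0_le_integralT => //.
  by apply/measurable_EFinP; exact: measurable_indic.
move=> x; rewrite indicE; have [xA|xA] := boolP (x \in A).
  exact/fA/set_mem.
by rewrite fNA// => /mem_set; exact/negP.
Qed.

Lemma mulgl_continuous (G : topologicalGroupType) (a : G) :
  continuous (fun x : G => (a * x)%g).
Proof.
move=> x; apply: (@continuous2_cvg _ _ _ _ _ _
  (fun=> a) id (fun x y => (x * y)%g)); last exact: cvg_id.
  exact: (@mulg_continuous G (a, x)).
exact: cvg_cst.
Qed.

(** * Real and imaginary parts of complex integrals *)

Lemma Re_mulr (R : realType) (z : R[i]) (r : R) :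
  complex.Re (z * r%:C) = complex.Re z * r.
Proof. by rewrite Re_scale /= mulr0 subr0. Qed.

Lemma Im_mulr (R : realType) (z : R[i]) (r : R) :
  complex.Im (z * r%:C) = complex.Im z * r.
Proof. by rewrite Im_scale /= mulr0 add0r. Qed.

Lemma complex_ext (R : realType) (z1 z2 : R[i]) :
  complex.Re z1 = complex.Re z2 -> complex.Im z1 = complex.Im z2 -> z1 = z2.
Proof. by case: z1 z2 => [a b] [a' b'] /= -> ->. Qed.

Lemma normc_le_ReIm (R : realType) (z : R[i]) :
  Normc.normc z <= `|complex.Re z| + `|complex.Im z|.
Proof.
case: z => a b /=; rewrite -[leRHS]ger0_norm ?addr_ge0// -sqrtr_sqr.
rewrite ler_wsqrtr// sqrrD !real_normK ?num_real// -addrA lerD2l lerDr.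
by rewrite mulrn_wge0 ?mulr_ge0.
Qed.

Lemma Re_le_normc (R : realType) (z : R[i]) : `|complex.Re z| <= Normc.normc z.
Proof. by case: z => a b /=; rewrite -sqrtr_sqr ler_wsqrtr// lerDl sqr_ge0. Qed.

Lemma Im_le_normc (R : realType) (z : R[i]) : `|complex.Im z| <= Normc.normc z.
Proof. by case: z => a b /=; rewrite -sqrtr_sqr ler_wsqrtr// lerDr sqr_ge0. Qed.

Lemma cintegral_linear d (T : measurableType d) (R : realType)
    (mu : {measure set T -> \bar R}) (a : R[i]) (f1 f2 : T -> R[i]) :
  cintegrable mu f1 -> cintegrable mu f2 ->
  cintegral mu (fun x => a * f1 x + f2 x) = a * cintegral mu f1 + cintegral mu f2.
Proof.
move=> [r1 i1] [r2 i2].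
have Z (k : R) (f : T -> R) : mu.-integrable setT (EFin \o f) ->
    mu.-integrable setT (EFin \o (fun x => k * f x)).
  by move=> /(integrableZl measurableT k).
apply: complex_ext; rewrite raddfD /= ?Re_scale ?Im_scale /=.
- under eq_Rintegral do rewrite raddfD /= Re_scale.
  rewrite RintegralD//; last first.
    exact: (integrableB measurableT (Z (complex.Re a) _ r1) (Z (complex.Im a) _ i1)).
  by rewrite RintegralB ?RintegralZl//; exact: Z.
- under eq_Rintegral do rewrite raddfD /= Im_scale.
  rewrite RintegralD//; last first.
    exact: (integrableD measurableT (Z (complex.Re a) _ i1) (Z (complex.Im a) _ r1)).
  by rewrite RintegralD ?RintegralZl//; exact: Z.
Qed.

(** * Weil's formula along the fibres of the quotient map *)

(* [p] stands for the quotient map onto [Q = G/H] and [fib q] for the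
   parametrisation [h |-> repr q * h] of the coset [q] by [S = H]. *)
Section Fibration.
Context (R : realType) (G S Q : topologicalGroupType) (p : G -> Q)
  (fib : Q -> S -> G).
Hypotheses (p_continuous : continuous p)
  (fib_continuous : forall q, continuous (fib q))
  (p_fib : forall q h, p (fib q h) = q).
Context (mG : {measure set (borel G) -> \bar R})
  (mS : {measure set (borel S) -> \bar R})
  (mQ : {measure set (borel Q) -> \bar R}).
Hypotheses (G_hausdorff : hausdorff_space G)
  (mG_haar : left_haar mG) (mQ_haar : left_haar mQ).
Implicit Types (q : Q) (h : S) (f : G -> R).

(** The values are extended reals, as the fibre integral of an integrable function may still be
    infinite on a null set of cosets; [fine] later replaces such values by 0. *)
Definition fiberint f q : \bar R := (\int[mS]_h (f (fib q h))%:E)%E.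

Hypothesis weil : forall f, mG.-integrable [set: G] (fun x => (f x)%:E) ->
  mQ.-integrable [set: Q] (fiberint f) /\
  (\int[mG]_x (f x)%:E = \int[mQ]_q fiberint f q)%E.

Context (g : G -> R).
Hypotheses (g_continuous : continuous g) (g_ge0 : forall x, 0 <= g x)
  (fiberint_g : forall q, fiberint g q = 1%E).

Let measurable_p : measurable_fun [set: borel G] (p : borel G -> borel Q).
Proof. exact: continuous_measurable_borel. Qed.

Let measurable_comp_fib f q : measurable_fun [set: borel G] f ->
  measurable_fun [set: borel S] (fun h => f (fib q h)).
Proof.
move=> mf; apply: (measurableT_comp mf).
exact: (continuous_measurable_borel (@fib_continuous q)).
Qed.

Let mg : measurable_fun [set: borel G] g.
Proof. exact: continuous_measurable_real. Qed.

Let open_superlevel t : open [set x | t < g x].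
Proof. by apply: (@open_comp _ _ g [set y | t < y]) => //; exact: open_gt. Qed.

(* The set on the left is open, so its measure is the supremum over its compact
   subsets [K], and the fibre integrals of [t * \1_K <= g] are at most [\1_U]. *)
Lemma superlevel_preimage_open_le (t : R) (U : set Q) :
  0 < t -> open U ->
  (t%:E * mG ([set x | (t < g x)%R] `&` p @^-1` U) <= mQ U)%E.
Proof.
move=> t0 oU; set V := _ `&` _.
have oV : open V.
  apply: openI; last by apply: open_comp => // x _; exact: p_continuous.
  exact: open_superlevel.
case: mG_haar => _ _ K_fin _ inner.
rewrite -lee_pdivlMl// (inner _ oV); apply: ge_ereal_sup => _ [K [cK KV] <-].
rewrite lee_pdivlMl//.
(* In a Hausdorff group the compact set [K] is closed, hence Borel. *)
have mK : measurable (K : set (borel G)).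
  rewrite -(setCK K); apply: measurableC; apply: borel_open.
  by apply: closed_openC; exact: compact_closed.
have intK : (\int[mG]_x (t * \1_K x)%:E = t%:E * mG K)%E.
  under eq_integral do rewrite EFinM.
  rewrite ge0_integralZl_EFin ?(ltW t0)//; first by rewrite integral_indic ?setIT.
  by apply/measurable_EFinP; exact: measurable_indic.
have iK := integrable_scale_indic t mK (K_fin _ cK).
have [iQ eQ] := weil iK.
rewrite -intK.
have mU : measurable (U : set (borel Q)) by exact: borel_open.
rewrite eQ; apply: integral_le_measure => //.
- exact: measurable_int iQ.
- by move=> q; apply: integral_ge0 => h _; rewrite lee_fin mulr_ge0// ltW.
- move=> q Uq; rewrite -[leRHS](fiberint_g q); apply: ge0_le_integralT.
  + apply/measurable_EFinP.
    apply: (measurable_comp_fib (f := fun x => t * \1_K x)).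
    by apply: measurable_funM => //; exact: measurable_indic.
  + by apply/measurable_EFinP; exact: measurable_comp_fib.
  + by move=> h; rewrite lee_fin mulr_ge0// ltW.
  + move=> h; rewrite lee_fin indicE; case: (boolP (_ \in K)) => xK.
      by rewrite mulr1; have /KV[/ltW] := set_mem xK.
    by rewrite mulr0.
- move=> q nUq; apply: integral0_eq => h _; rewrite indicE memNset ?mulr0//.
  by move=> /KV[_ /=]; rewrite p_fib.
Qed.

(** By outer regularity [mQ E] is the infimum of [mQ U] over open [U] containing [E], and enlarging
    [E] to [U] only increases the left-hand side. *)
Lemma superlevel_preimage_le (t : R) (E : set (borel Q)) :
  0 < t -> measurable E ->
  (t%:E * mG ([set x | (t < g x)%R] `&` p @^-1` E) <= mQ E)%E.
Proof.
move=> t0 mE; case: mQ_haar => _ _ _ outer _.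
have mgt : measurable ([set x | t < g x] : set (borel G)).
  by apply: borel_open; exact: open_superlevel.
rewrite (outer E mE); apply: le_ereal_inf_tmp => _ [U [oU EU] <-].
apply: le_trans (superlevel_preimage_open_le t0 oU).
rewrite lee_wpmul2l ?lee_fin ?(ltW t0)//; apply: le_measure; rewrite ?inE.
- by apply: measurableI => //; rewrite -[X in measurable X]setTI;
    exact: measurable_p.
- by apply: measurableI => //; rewrite -[X in measurable X]setTI;
    apply: measurable_p => //; exact: borel_open.
- by apply: setIS => x; exact: EU.
Qed.

(** The preimage of a null set [E] need not be null, but its part where [g > 0] is the countable
    union of the sets [A n], each null by the superlevel estimate. *)
Lemma ae_lift (P : set Q) :
  (\forall q \ae mQ, P q) -> \forall x \ae mG, g x != 0 -> P (p x).
Proof.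
move=> [E [mE E0 PE]].
pose A n := [set x | n.+1%:R^-1 < g x] `&` p @^-1` E.
have mA n : measurable (A n : set (borel G)).
  apply: measurableI; last first.
    by rewrite -[X in measurable X]setTI; exact: measurable_p.
  by apply: borel_open; exact: open_superlevel.
have : mG.-negligible (\bigcup_n A n).
  apply: negligible_bigcup => n; apply/negligibleP => //; apply/eqP.
  have n0 : 0 < n.+1%:R^-1 :> R by rewrite invr_gt0.
  have := superlevel_preimage_le n0 mE.
  by rewrite E0 pmule_rle0 ?lte_fin// measure_le0.
apply: negligibleS => x /= /not_implyP[gx0 nPx].
have gx : 0 < g x by rewrite lt_neqAle eq_sym gx0 g_ge0.
(* With [n] the integer part of [1 / g x] one has [1 / g x < n + 1], so [g x] exceeds
   [1 / (n + 1)]. *)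
exists (Num.truncn (g x)^-1) => //; split; last exact: PE.
by rewrite /= invf_plt ?posrE//; exact: truncnS_gt.
Qed.

(** * Almost everywhere statements on fibres, and a converse estimate *)

(** Weil's formula applies to [|f1 - f2|], which is integrable with integral 0. Its fibre integral
    therefore vanishes for almost every [q], and on such a fibre [f1] and [f2] agree almost
    everywhere. *)
Lemma fiberint_ae_eq f1 f2 :
  measurable_fun [set: borel G] f1 -> measurable_fun [set: borel G] f2 ->
  (\forall x \ae mG, f1 x = f2 x) ->
  \forall q \ae mQ, fiberint f1 q = fiberint f2 q.
Proof.
move=> mf1 mf2 f12; pose f x := `|f1 x - f2 x|.
have mf : measurable_fun [set: borel G] f.
  by apply: measurableT_comp => //; exact: measurable_funB.
have f0 : (\int[mG]_x `|(f x)%:E| = 0)%E.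
  apply/ae_eq_integral_abs => //; first exact/measurable_EFinP.
  apply: (@filterS _ _ (ae_filter_ringOfSetsType mG)) f12 => x fx _.
  by rewrite /f fx subrr normr0.
have ifm : mG.-integrable [set: G] (fun x => (f x)%:E).
  by apply/integrableP; split; [exact/measurable_EFinP|rewrite f0].
have [iQ eQ] := weil ifm.
have : (\int[mQ]_q `|fiberint f q| = 0)%E.
  rewrite -[RHS]f0; under [RHS]eq_integral do rewrite gee0_abs ?lee_fin ?normr_ge0//.
  rewrite eQ; apply: eq_integral => q _; rewrite gee0_abs//.
  by apply: integral_ge0 => h _; rewrite lee_fin normr_ge0.
move=> /ae_eq_integral_abs => /(_ measurableT (measurable_int _ iQ)).
apply: filterS => q /(_ I) fq.
apply: ae_eq_integral => //.
- by apply/measurable_EFinP; exact: measurable_comp_fib.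
- by apply/measurable_EFinP; exact: measurable_comp_fib.
have : (\int[mS]_h `|(f (fib q h))%:E| = 0)%E.
  by rewrite -[RHS]fq; apply: eq_integral => h _; rewrite gee0_abs// lee_fin normr_ge0.
move=> /ae_eq_integral_abs; case => //.
  by apply/measurable_EFinP; exact: measurable_comp_fib.
move=> A [mA A0 fA]; exists A; split => // h /= nh; apply: fA => /= fh.
apply: nh => _; congr EFin; apply/eqP; rewrite -subr_eq0 -normr_eq0.
by have /eqP := fh I; rewrite eqe.
Qed.

(** By Weil's formula the fibre integral of [|f|] is integrable on the quotient, hence finite almost
    everywhere. *)
Lemma fib_integrable_ae f : mG.-integrable [set: G] (fun x => (f x)%:E) ->
  \forall q \ae mQ, mS.-integrable [set: S] (fun h => (f (fib q h))%:E).
Proof.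
move=> intf; have mf : measurable_fun [set: borel G] f.
  by apply/measurable_EFinP; exact: measurable_int intf.
have [iQ _] := weil (f := fun x => `|f x|) (integrable_abse intf).
have := integrable_ae measurableT iQ; apply: filterS => q /(_ I) fq.
apply/integrableP; split.
  by apply/measurable_EFinP; exact: measurable_comp_fib.
by move: fq; rewrite fin_numElt => /andP[].
Qed.

(* The converse half of Weil's formula for nonnegative functions; without
   sigma-finiteness of [mG] it needs the exhaustion [A] of the support. *)
Lemma integral_le_fiberint f (A : nat -> set (borel G)) (F : Q -> \bar R) :
  measurable_fun [set: borel G] f -> (forall x, 0 <= f x) ->
  (forall n, measurable (A n)) -> (forall n, mG (A n) < +oo)%E ->
  {homo A : m n / (m <= n)%N >-> m `<=` n} ->
  (forall x, f x != 0 -> exists n, A n x) ->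
  measurable_fun [set: borel Q] F -> (forall q, fiberint f q <= F q)%E ->
  (\int[mG]_x (f x)%:E <= \int[mQ]_q F q)%E.
Proof.
move=> mf f0 mA A_fin ndA suppA mF fF.
(* Cutting off at height [n] as well bounds [f] on [B n] by the integrable function [n * \1_(A n)],
   so that Weil's formula applies to [f * \1_(B n)]. *)
pose B n : set (borel G) := A n `&` [set x | f x <= n%:R].
have mB n : measurable (B n).
  apply: measurableI => //; rewrite -preimage_itvNyc -[X in measurable X]setTI.
  exact: mf.
have ndB : nondecreasing_seq B.
  move=> m n mn; apply/subsetPset => x [/(ndA _ _ mn) Anx fxm]; split => //=.
  by apply: le_trans fxm _; rewrite ler_nat.
have leB n : (\int[mG]_(x in B n) (f x)%:E <= \int[mQ]_q F q)%E.
  rewrite integral_mkcond.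
  have fB x : (((fun x => (f x)%:E) \_ (B n)) x = (f x * \1_(B n) x)%:E)%E.
    by rewrite patchE indicE; case: ifP; rewrite ?mulr1 ?mulr0.
  under eq_integral do rewrite fB.
  have mfB : measurable_fun [set: borel G] (fun x => f x * \1_(B n) x).
    by apply: measurable_funM => //; exact: measurable_indic.
  have ifB : mG.-integrable [set: G] (fun x => (f x * \1_(B n) x)%:E).
    apply: (le_integrable measurableT _ _
      (integrable_scale_indic n%:R (mA n) (A_fin n))).
      exact/measurable_EFinP.
    move=> x _; rewrite lee_fin !indicE; case: (boolP (x \in B n)) => xB.
      have [Ax fx] := set_mem xB.
      by rewrite mem_set// !mulr1 ger0_norm// ger0_norm.
    by rewrite mulr0 normr0.
  have [iQ ->] := weil ifB.
  apply: ge0_le_integralT => //; first exact: measurable_int iQ.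
    by move=> q; apply: integral_ge0 => h _; rewrite lee_fin mulr_ge0.
  move=> q; apply: le_trans (fF q); apply: ge0_le_integralT.
  - by apply/measurable_EFinP; exact: measurable_comp_fib mfB.
  - by apply/measurable_EFinP; exact: measurable_comp_fib mf.
  - by move=> h; rewrite lee_fin mulr_ge0.
  - by move=> h; rewrite lee_fin ler_piMr// indicE lern1 leq_b1.
(* The sets [B n] exhaust the support of [f]: a large enough index passes both the exhaustion index
   of [x] and the value [f x]. *)
have fUB : (\int[mG]_x (f x)%:E = \int[mG]_(x in \bigcup_n B n) (f x)%:E)%E.
  rewrite [RHS]integral_mkcond; apply: eq_integral => x _; rewrite patchE.
  case: ifPn => // xB; congr EFin; apply/eqP; apply: contraNT xB.
  move=> /suppA[m Amx]; apply/mem_set.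
  exists (maxn m (Num.truncn (f x)).+1) => //; split.
    exact: (ndA m _ (leq_maxl _ _)).
  apply: (@le_trans _ _ (Num.truncn (f x)).+1%:R).
    exact/ltW/truncnS_gt.
  by rewrite ler_nat leq_maxr.
(* Monotone convergence carries the uniform bound [leB] to the union. *)
have cvgB : (\int[mG]_(x in B n) (f x)%:E)%E @[n --> \oo] -->
    (\int[mG]_(x in \bigcup_n B n) (f x)%:E)%E.
  apply: ge0_nondecreasing_set_cvg_integral => //.
    by move=> n; apply: measurable_funTS; exact/measurable_EFinP.
  by move=> n x _; exact: f0.
rewrite fUB -(cvg_lim _ cvgB)//; apply: lime_le; last exact: nearW.
by apply/cvg_ex; eexists; exact: cvgB.
Qed.

(** * The weighted estimate, with [W] in place of the quotient weight *)

Context (w : G -> R) (W : Q -> R) (c d : R).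
Hypotheses (w_gt0 : forall x, 0 < w x) (w_continuous : continuous w) (d_gt0 : 0 < d)
  (w_ged : forall x, d <= w x) (W_ge0 : forall q, 0 <= W q)
  (W_le : forall q h, W q <= w (fib q h)) (c_ge0 : 0 <= c)
  (gw_int : forall q, (fiberint (fun x => g x * w x)%R q <= (c * W q)%:E)%E).

Let mw : measurable_fun [set: borel G] w.
Proof. exact: continuous_measurable_real. Qed.

Let measurable_of_weighted f :
  mG.-integrable [set: G] (fun x => (f x * w x)%:E) ->
  measurable_fun [set: borel G] f.
Proof.
move=> /measurable_int/measurable_EFinP mfw.
rewrite (_ : f = fun x => (f x * w x) * (w x)^-1); last first.
  by apply/funext => x; rewrite mulfK// gt_eqF.
apply: measurable_funM => //; apply: continuous_measurable_real => x.
by apply: cvgV; [rewrite gt_eqF|exact: w_continuous].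
Qed.

(** Since [d <= w], the function [|f|] is dominated by [d^-1 * |f| * w]; this opens Weil's formula
    to weighted integrable functions. *)
Lemma integrable_of_weighted f :
  mG.-integrable [set: G] (fun x => (f x * w x)%:E) ->
  mG.-integrable [set: G] (fun x => (f x)%:E).
Proof.
move=> ifw; apply: (le_integrable measurableT _ _
  (integrableZl measurableT d^-1 ifw)).
  by apply/measurable_EFinP; exact: measurable_of_weighted.
move=> x _; rewrite lee_fin !normrM mulrCA (gtr0_norm (w_gt0 x)).
by rewrite (gtr0_norm (x := d^-1)) ?invr_gt0// ler_peMr// ler_pdivlMl// mulr1.
Qed.

(** Integrability of the lift cannot be presupposed, so the bound comes from [integral_le_fiberint],
    and integrability is then read off from it. *)
Lemma weighted_lift_bound f :
  mG.-integrable [set: G] (fun x => (f x * w x)%:E) ->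
  mG.-integrable [set: G] (fun x => (fine (fiberint f (p x)) * g x * w x)%:E) /\
  (\int[mG]_x `|(fine (fiberint f (p x)) * g x * w x)%:E| <=
     c%:E * \int[mG]_x `|(f x * w x)%:E|)%E.
Proof.
move=> ifw; have mf := measurable_of_weighted ifw.
have [iQ _] := weil (integrable_of_weighted ifw).
have mQf := measurable_int _ iQ.
have [iQw eQw] := weil (f := fun x => `|f x * w x|) (integrable_abse ifw).
have mQw := measurable_int _ iQw.
pose T q := fine (fiberint f q).
have mT : measurable_fun [set: borel G] (fun x => T (p x) * g x * w x).
  apply: measurable_funM => //; apply: measurable_funM => //.
  apply: (measurableT_comp _ measurable_p).
  by apply: (measurableT_comp _ mQf); exact: fine_measurable.
(* Where the fibre integral is infinite, [fine] gives 0 and the inequality persists. *)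
have T_le q : (`|T q|%:E <= `|fiberint f q|)%E.
  by rewrite /T; case: (fiberint f q) => [r||] /=; rewrite ?normr0 ?leey.
suff le_int : (\int[mG]_x `|(T (p x) * g x * w x)%:E| <=
    c%:E * \int[mG]_x `|(f x * w x)%:E|)%E.
  split => //; apply/integrableP; split; first exact/measurable_EFinP.
  apply: le_lt_trans le_int _; apply: lte_mul_pinfty => //.
  by have /integrableP[] := ifw.
rewrite [X in (_ <= _ * X)%E]eQw.
rewrite -ge0_integralZl_EFin//; last first.
  by move=> q _; apply: integral_ge0 => h _; rewrite lee_fin normr_ge0.
(* These sets have finite measure by Markov's inequality for the integrable [fiberint f]. The
   superlevel estimate passes finiteness on to the part of their preimages where [g > 1 / (n + 1)],
   and these parts exhaust the support of the lift. *)
pose E n := [set: Q] `&` [set q | (n.+1%:R^-1%:E <= `|fiberint f q|)%E].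
have mE n : measurable (E n : set (borel Q)).
  apply: emeasurable_fun_c_infty => //.
  by apply: (measurableT_comp _ mQf); exact: abse_measurable.
have Sn0 n : 0 < n.+1%:R^-1 :> R by rewrite invr_gt0.
apply: (integral_le_fiberint (f := fun x => `|T (p x) * g x * w x|)
   (A := fun n => [set x | n.+1%:R^-1 < g x] `&` p @^-1` E n)).
- exact: measurableT_comp.
- by [].
- move=> n; apply: measurableI; first by apply: borel_open; exact: open_superlevel.
  by rewrite -[X in measurable X]setTI; exact: measurable_p.
- move=> n; rewrite ltNge leye_eq; apply/negP => /eqP Aoo.
  have := superlevel_preimage_le (Sn0 n) (mE n).
  rewrite Aoo gt0_muley ?lte_fin// leye_eq => /eqP Eoo.
  have := le_integral_abse mQ measurableT mQf (Sn0 n).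
  rewrite -[X in mQ X]/(E n) Eoo gt0_muley ?lte_fin// leye_eq => /eqP foo.
  by have /integrableP[_] := iQ; rewrite foo.
- move=> m n mn x [gx [_ fx]].
  have nm : n.+1%:R^-1 <= m.+1%:R^-1 :> R by rewrite lef_pV2 ?posrE// ler_nat.
  split; first exact: le_lt_trans gx.
  by split => //; apply: le_trans fx; rewrite lee_fin.
- move=> x; rewrite normr_eq0 !mulf_eq0 !negb_or -andbA => /and3P[Tx gx0 _].
  have gx : 0 < g x by rewrite lt_neqAle eq_sym gx0 g_ge0.
  have inv_lt (n : nat) (y : R) : 0 < y -> (Num.truncn y^-1 <= n)%N ->
      n.+1%:R^-1 < y.
    move=> y0 yn; rewrite invf_plt ?posrE//.
    by apply: lt_le_trans (truncnS_gt _) _; rewrite ler_nat.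
  exists (maxn (Num.truncn (g x)^-1) (Num.truncn `|T (p x)|^-1)); split.
    by apply: inv_lt => //; exact: leq_maxl.
  split => //=; apply: le_trans (T_le _).
  by rewrite lee_fin ltW// inv_lt ?normr_gt0//; exact: leq_maxr.
- exact: measurable_funeM.
(* Along the fibre, [T (p x)] is the constant [T q]; it comes out of the integral, leaving that of
   [g * w]. *)
- move=> q.
  have -> : fiberint (fun x => `|T (p x) * g x * w x|)%R q =
      (`|T q|%:E * fiberint (fun x => g x * w x)%R q)%E.
    rewrite -ge0_integralZl_EFin//; last 2 first.
    + by move=> h _; rewrite lee_fin mulr_ge0 ?g_ge0// ltW.
    + apply/measurable_EFinP.
      apply: (measurable_comp_fib (f := fun x => g x * w x)).
      exact: measurable_funM.
    apply: eq_integral => h _; rewrite p_fib -EFinM -mulrA normrM.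
    by congr (_ * _)%:E; rewrite ger0_norm// mulr_ge0 ?g_ge0// ltW.
  apply: (@le_trans _ _ (`|T q|%:E * (c * W q)%:E)%E).
    by apply: lee_wpmul2l => //; rewrite lee_fin.
  rewrite EFinM muleCA lee_wpmul2l ?lee_fin// muleC.
  (* Now [W q] moves inside the fibre integral, where it is dominated by [w]. *)
  apply: (@le_trans _ _ ((W q)%:E * \int[mS]_h `|(f (fib q h))%:E|)%E).
    rewrite lee_wpmul2l ?lee_fin//; apply: le_trans (T_le _) _.
    apply: le_abse_integral => //.
    by apply/measurable_EFinP; exact: measurable_comp_fib.
  rewrite -ge0_integralZl_EFin//; last first.
    by apply: measurableT_comp => //; apply/measurable_EFinP;
      exact: measurable_comp_fib.
  apply: ge0_le_integralT.
  + apply: measurable_funeM; apply: measurableT_comp => //.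
    by apply/measurable_EFinP; exact: measurable_comp_fib.
  + apply/measurable_EFinP.
    apply: (measurable_comp_fib (f := fun x => `|f x * w x|)).
    by apply: measurableT_comp => //; exact: measurable_funM.
  + by move=> h; rewrite mule_ge0// lee_fin.
  + move=> h; rewrite -EFinM lee_fin normrM mulrC ler_wpM2l//.
    exact: le_trans (W_le _ _) (ler_norm _).
Qed.

(** * Complex fibre integrals and the lift on functions *)

Implicit Types F : wLfun mG w.

Definition fiber_cint (f : G -> R[i]) q : R[i] :=
  cintegral mS (fun h => f (fib q h)).

Let Re_fiber_cint (f : G -> R[i]) q :
  complex.Re (fiber_cint f q) = fine (fiberint (fun x => complex.Re (f x)) q).
Proof. by []. Qed.

Let Im_fiber_cint (f : G -> R[i]) q :
  complex.Im (fiber_cint f q) = fine (fiberint (fun x => complex.Im (f x)) q).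
Proof. by []. Qed.

Let wLfun_Re F :
  mG.-integrable [set: G] (fun x => (complex.Re (F x) * w x)%:E).
Proof.
have /asboolP[+ _] : (F : G -> R[i]) \in wLfun_pred mG w by exact: valP.
by under eq_fun do rewrite Re_mulr.
Qed.

Let wLfun_Im F :
  mG.-integrable [set: G] (fun x => (complex.Im (F x) * w x)%:E).
Proof.
have /asboolP[_] : (F : G -> R[i]) \in wLfun_pred mG w by exact: valP.
by under eq_fun do rewrite Im_mulr.
Qed.

Lemma fiber_cint_ae_eq F1 F2 : (F1 : G -> R[i]) = F2 %[ae mG] ->
  \forall q \ae mQ, fiber_cint F1 q = fiber_cint F2 q.
Proof.
move=> F12.
have re : \forall q \ae mQ, fiberint (fun x => complex.Re (F1 x)) q =
    fiberint (fun x => complex.Re (F2 x)) q.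
  apply: fiberint_ae_eq; [exact: measurable_of_weighted..|].
  by apply: (@filterS _ _ (ae_filter_ringOfSetsType mG)) F12 => x /(_ I) ->.
have im : \forall q \ae mQ, fiberint (fun x => complex.Im (F1 x)) q =
    fiberint (fun x => complex.Im (F2 x)) q.
  apply: fiberint_ae_eq; [exact: measurable_of_weighted..|].
  by apply: (@filterS _ _ (ae_filter_ringOfSetsType mG)) F12 => x /(_ I) ->.
apply: (@filterS2 _ _ (ae_filter_ringOfSetsType mQ)) re im => q req imq.
by apply: complex_ext; rewrite ?Re_fiber_cint ?Im_fiber_cint ?req ?imq.
Qed.

(** Linearity can fail on the null set of cosets where a fibre integral diverges and takes a default
    value. *)
Lemma fiber_cint_linear a F1 F2 : \forall q \ae mQ,
  fiber_cint (a *: F1 + F2) q = a * fiber_cint F1 q + fiber_cint F2 q.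
Proof.
have ci F : \forall q \ae mQ, cintegrable mS (fun h => F (fib q h)).
  have re := fib_integrable_ae (integrable_of_weighted (wLfun_Re F)).
  have im := fib_integrable_ae (integrable_of_weighted (wLfun_Im F)).
  by apply: (@filterS2 _ _ (ae_filter_ringOfSetsType mQ)) re im.
apply: (@filterS2 _ _ (ae_filter_ringOfSetsType mQ)) (ci F1) (ci F2) => q c1 c2.
exact: cintegral_linear.
Qed.

(** This is the map P before passage to classes. *)
Definition lift_fun (f : G -> R[i]) x : R[i] := fiber_cint f (p x) * (g x)%:C.

Lemma lift_fun_wLfun F : lift_fun F \in wLfun_pred mG w.
Proof.
apply/asboolP; split.
  under eq_fun do rewrite Re_mulr Re_mulr Re_fiber_cint.
  by have [] := weighted_lift_bound (wLfun_Re F).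
under eq_fun do rewrite Im_mulr Im_mulr Im_fiber_cint.
by have [] := weighted_lift_bound (wLfun_Im F).
Qed.

Definition lift F : wLfun mG w := WLfun (lift_fun_wLfun F).

(** This is the identity TP = T: on each fibre the lift is a constant times [g], and [g] has fibre
    integral 1. It holds at every [q], because [fine] makes the constant a real number in all
    cases. *)
Lemma fiber_cint_lift F q : fiber_cint (lift F) q = fiber_cint F q.
Proof.
have E (f : G -> R) : fine (fiberint (fun x => fine (fiberint f (p x)) * g x)%R q) =
    fine (fiberint f q).
  have gint : mS.-integrable [set: S] (fun h => (g (fib q h))%:E).
    apply/integrableP; split.
      by apply/measurable_EFinP; exact: measurable_comp_fib.
    under eq_integral do rewrite gee0_abs ?lee_fin//.
    by have := fiberint_g q; rewrite /fiberint => ->; rewrite ltry.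
  rewrite /fiberint; under eq_integral do rewrite p_fib EFinM.
  rewrite integralZl//; have := fiberint_g q; rewrite /fiberint => ->.
  by rewrite mule1.
apply: complex_ext.
- rewrite !Re_fiber_cint -[RHS]E; congr fine; apply: eq_integral => h _.
  by rewrite -Re_fiber_cint -Re_mulr.
- rewrite !Im_fiber_cint -[RHS]E; congr fine; apply: eq_integral => h _.
  by rewrite -Im_fiber_cint -Im_mulr.
Qed.

(** The factor 2 arises from estimating real and imaginary parts separately, each contributing [c]
    times the norm of [F]. *)
Lemma wLnorm_lift F : wLnorm mG w (lift F) <= 2 * c * wLnorm mG w F.
Proof.
have n0 (f : G -> R[i]) x : 0 <= Normc.normc (f x) * w x.
  by rewrite mulr_ge0 ?(ltW (w_gt0 x))//; case: (f x) => ? ?; exact: sqrtr_ge0.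
have ebound (f : G -> R) : mG.-integrable [set: G] (fun x => (f x * w x)%:E) ->
    (forall x, `|f x| <= Normc.normc (F x)) ->
  (\int[mG]_x `|(fine (fiberint f (p x)) * g x * w x)%:E| <=
     c%:E * (wLnorm mG w F)%:E)%E.
  move=> ifw fF; have [_ le1] := weighted_lift_bound ifw.
  apply: (le_trans le1); rewrite lee_wpmul2l ?lee_fin//.
  have iF := wLfun_integrable (mu := mG) w_gt0 F.
  rewrite /wLnorm fineK; last exact: integrable_fin_num.
  apply: ge0_le_integralT => //.
  - by apply: measurableT_comp => //; exact: measurable_int ifw.
  - exact: measurable_int iF.
  - move=> x; rewrite lee_fin normrM (gtr0_norm (w_gt0 x)).
    by rewrite ler_wpM2r ?(ltW (w_gt0 x)).
have iL := wLfun_integrable (mu := mG) w_gt0 (lift F).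
rewrite -lee_fin /wLnorm fineK; last exact: integrable_fin_num.
have [iR _] := weighted_lift_bound (wLfun_Re F).
have [iI _] := weighted_lift_bound (wLfun_Im F).
pose A x := `|(fine (fiberint (fun x => complex.Re (F x)) (p x)) * g x * w x)%:E|%E.
pose B x := `|(fine (fiberint (fun x => complex.Im (F x)) (p x)) * g x * w x)%:E|%E.
have mA : measurable_fun [set: borel G] A.
  by apply: measurableT_comp => //; exact: measurable_int iR.
have mB : measurable_fun [set: borel G] B.
  by apply: measurableT_comp => //; exact: measurable_int iI.
apply: (@le_trans _ _ (\int[mG]_x (A x + B x))%E).
  apply: ge0_le_integralT.
  - exact: measurable_int iL.
  - exact: emeasurable_funD.
  - by move=> x; rewrite lee_fin; exact: n0.
  - move=> x; rewrite /A /B -EFinD lee_fin !normrM -!mulrDl.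
    rewrite (gtr0_norm (w_gt0 x)) ler_wpM2r ?(ltW (w_gt0 x))//.
    rewrite (le_trans (normc_le_ReIm _))// -[lift F x]/(lift_fun F x).
    by rewrite Re_mulr Im_mulr Re_fiber_cint Im_fiber_cint !normrM -mulrDl.
rewrite ge0_integralD//; [|by move=> x _; exact: abse_ge0..].
rewrite -mulrA mulr_natl mulr2n EFinD EFinM; apply: leeD.
  exact: ebound (wLfun_Re F) (fun x => Re_le_normc _).
exact: ebound (wLfun_Im F) (fun x => Im_le_normc _).
Qed.

(** * The projection on classes *)

Local Notation L1 := (wL1 mG w_gt0).

Definition projection (f : L1) : L1 := wL1_class (mu := mG) w_gt0 (lift (repr f)).

(** Representatives of one class have the same fibre integrals over almost every [q]. By [ae_lift]
    the lifts then agree almost everywhere on [g != 0], and where [g] vanishes both are 0. *)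
Lemma projection_class F :
  projection (wL1_class (mu := mG) w_gt0 F) = wL1_class (mu := mG) w_gt0 (lift F).
Proof.
apply/wL1_eqP.
have := ae_lift (fiber_cint_ae_eq (wL1_classK (mu := mG) w_gt0 F)).
apply: (@filterS _ _ (ae_filter_ringOfSetsType mG)) => x gP _.
rewrite /= /lift_fun.
by have [->|/gP ->//] := eqVneq (g x) 0; rewrite !mulr0.
Qed.

Lemma projection_linear : linear projection.
Proof.
move=> a f1 f2; rewrite -(wL1_funK f1) -(wL1_funK f2).
rewrite -wL1_classZ -wL1_classD !projection_class -wL1_classZ -wL1_classD.
apply/wL1_eqP; have := ae_lift (fiber_cint_linear a (repr f1) (repr f2)).
apply: (@filterS _ _ (ae_filter_ringOfSetsType mG)) => x gP _.
transitivity (a * lift_fun (repr f1) x + lift_fun (repr f2) x) => //.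
rewrite /= /lift_fun.
by have [->|/gP ->//] := eqVneq (g x) 0; rewrite ?mulr0 ?addr0// mulrA -mulrDl.
Qed.

HB.instance Definition _ := GRing.isLinear.Build R[i] L1 L1 *:%R projection
  projection_linear.

Lemma projection_exists :
  exists P : {linear L1 -> L1},
    [/\ forall f : L1, \forall x \ae mG, wL1_fun (P f) x =
          fiber_cint (wL1_fun f) (p x) * (g x)%:C,
        continuous P,
        forall f : L1, P (P f) = P f &
        [set f : L1 | P f = 0] =
        [set f : L1 | fiber_cint (wL1_fun f) = (fun=> 0) %[ae mQ]]].
Proof.
exists projection; split.
- move=> f; have := wL1_classK (mu := mG) w_gt0 (lift (repr f)).
  by apply: (@filterS _ _ (ae_filter_ringOfSetsType mG)) => x /(_ I).
(* Continuity is boundedness: every [r] beyond [2 * c] is an admissible bound. *)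
- apply: bounded_linear_continuous; apply/linear_boundedP.
  near=> r => f; change (wL1_norm (projection f) <= r * wL1_norm f).
  rewrite -(wL1_funK f) projection_class.
  rewrite !wL1_normE; set N := wLnorm mG w (repr f).
  apply: (@le_trans _ _ (2 * c * N)%:C); first by rewrite lecR wLnorm_lift.
  rewrite rmorphM ler_wpM2r//; last by near: r; apply: nbhs_pinfty_ge;
    rewrite ger0_real// -[0]/(0%:C) lecR mulr_ge0.
  rewrite -[0]/(0%:C) lecR; apply: Rintegral_ge0 => x _.
  by rewrite mulr_ge0 ?(ltW (w_gt0 x))//; case: (repr f x) => ? ?; exact: sqrtr_ge0.
(* Idempotence already holds pointwise for the lifts, by TP = T. *)
- move=> f; change (projection (projection f) = projection f).
  rewrite -(wL1_funK f) !projection_class.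
  congr wL1_class; apply: val_inj; apply/funext => x.
  by rewrite /= /lift_fun fiber_cint_lift.
- apply/seteqP; split => f /=.
  (* If Pf = 0 then Tf = T(Pf) vanishes almost everywhere. *)
  + move=> Pf0; have {}Pf0 : projection f = 0 by [].
    have : (lift (repr f) : G -> R[i]) = (0 : wLfun mG w) %[ae mG].
      by apply/(wL1_eqP (mu := mG) w_gt0); rewrite wL1_class0.
    move=> /fiber_cint_ae_eq.
    apply: (@filterS _ _ (ae_filter_ringOfSetsType mQ)) => q Tq _.
    rewrite -[LHS](fiber_cint_lift (repr f)) Tq.
    by apply: complex_ext;
      rewrite ?Re_fiber_cint ?Im_fiber_cint /fiberint integral0_eq.
  (* Conversely, [ae_lift] carries the vanishing of Tf to almost every [x] with [g x != 0]. *)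
  + move=> Tf; change (projection f = 0).
    rewrite -(wL1_class0 mG w_gt0); apply/wL1_eqP; have := ae_lift Tf.
    apply: (@filterS _ _ (ae_filter_ringOfSetsType mG)) => x gP _.
    rewrite /= /lift_fun.
    by have [->|/gP /(_ I) ->] := eqVneq (g x) 0; rewrite ?mulr0 ?mul0r.
Unshelve. all: by end_near. Qed.

End Fibration.

(** * Cosets as fibres, and the theorem *)

Section Fibers.
Context (R : realType) (G : topologicalGroupType) (H : normalSubgroup G).
Implicit Types (q : quotient_of H) (h : subgroup_of H).

Lemma coset_of_fiber q h : coset_of H (repr q * subg_incl h)%g = q.
Proof.
rewrite -[RHS]coset_of_repr; apply/coset_ofP.
by rewrite invgM -mulgA mulVg mulg1; apply: nsV; exact: subg_inclP.
Qed.

Lemma fiber_continuous q :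
  continuous (fun h : subgroup_of H => (repr q * subg_incl h)%g).
Proof.
move=> h.
apply: (@continuous_comp _ _ _ (@subg_incl G H) (fun x : G => (repr q * x)%g)).
  exact: subg_incl_continuous.
exact: mulgl_continuous.
Qed.

(** The bound [d] guarantees that [inf] is taken over a set bounded below and so is a true
    infimum. *)
Lemma hat_weight_le (w : G -> R) (d : R) q h :
  (forall x, d <= w x) -> hat_weight w q <= w (repr q * subg_incl h)%g.
Proof.
move=> w_ged; apply: ge_inf; last by exists h.
by exists d => _ [k _ <-]; exact: w_ged.
Qed.

Lemma hat_weight_ge (w : G -> R) (d : R) q :
  (forall x, d <= w x) -> d <= hat_weight w q.
Proof.
move=> w_ged; apply: lb_le_inf; first by eexists; exists 1%g.
by move=> _ [k _ <-]; exact: w_ged.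
Qed.

End Fibers.

Theorem theorem4p5 (R : realType) (G : topologicalGroupType)
    (G_hausdorff : hausdorff_space G)
    (G_lc : locally_compact [set: G])
    (H : normalSubgroup G) (H_closed : closed (ns_set H))
    (mG : {measure set (borel G) -> \bar R})
    (mH : {measure set (borel (subgroup_of H)) -> \bar R})
    (mQ : {measure set (borel (quotient_of H)) -> \bar R})
    (mG_haar : left_haar mG) (mH_haar : left_haar mH) (mQ_haar : left_haar mQ)
    (weil : weil_formula mG mH mQ)
    (w : G -> R) (w_gt0 : forall x, 0 < w x) (w_continuous : continuous w)
    (w_submul : forall x y : G, w (x * y)%g <= w x * w y)
    (w_away0 : exists2 d : R, 0 < d & forall x, d <= w x)
    (g : G -> R) (g_continuous : continuous g) (g_ge0 : forall x, 0 <= g x)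
    (c : R) (c_gt0 : 0 < c)
    (g_int : forall x : G, (\int[mH]_h (g (x * subg_incl h)%g)%:E = 1)%E)
    (gw_int : forall x : G,
      (\int[mH]_h (g (x * subg_incl h)%g * w (x * subg_incl h)%g)%:E
         <= (c * hat_weight w (coset_of H x))%:E)%E) :
  exists P : {linear wL1 mG w_gt0 -> wL1 mG w_gt0},
    [/\ forall f : wL1 mG w_gt0,
          \forall x \ae mG, wL1_fun (P f) x =
            coset_integral mH (wL1_fun f) (coset_of H x) * (g x)%:C,
        continuous P,
        forall f : wL1 mG w_gt0, P (P f) = P f &
        [set f : wL1 mG w_gt0 | P f = 0] = kernel_ideal mG mH mQ w_gt0].
Proof.
have [d d_gt0 w_ged] := w_away0.
apply: (projection_exists (@coset_of_continuous G H) (@fiber_continuous G H)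
  (@coset_of_fiber G H) G_hausdorff mG_haar mQ_haar weil g_continuous g_ge0 _
  w_gt0 w_continuous d_gt0 w_ged (W := hat_weight w) _ _ (ltW c_gt0) _).
- by move=> q; exact: g_int.
- by move=> q; apply: le_trans (hat_weight_ge q w_ged); exact: ltW.
- by move=> q h; exact: hat_weight_le w_ged.
(* The fibre over [q] is parametrised from [repr q], so the hypothesis is used at [x = repr q]. *)
- by move=> q; rewrite -{2}(coset_of_repr q); exact: gw_int.
Qed.
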